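(* Let $\mathbb{T}=\mathbb{R}/\mathbb{Z}$, let $\alpha\in\mathbb{R}\setminus\mathbb{Q}$, let $T:\mathbb{T}^2\to\mathbb{T}^2$ be a hyperbolic toral automorphism, let $h:\mathbb{T}\to\mathbb{T}^2$ be continuous, and let $\Theta:\mathbb{T}\times\mathbb{T}^2\to\mathbb{T}\times\mathbb{T}^2$ be $\Theta(\omega,x)=(\omega+\alpha,\,Tx+h(\omega))$. Let $\varphi\in C(\mathbb{T}\times\mathbb{T}^2,\mathbb{R})$. Then $I_\varphi$ is either empty or dense in $\mathbb{T}\times\mathbb{T}^2$.
   Context: Irregular set: $I_\varphi=\{(\omega,x)\in\mathbb{T}\times\mathbb{T}^2:\lim_{n\to\infty}\frac1n\sum_{i=0}^{n-1}\varphi(\Theta^i(\omega,x))\text{ does not exist}\}$. *)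

(* Defs.v *)
From HB Require Import structures.
From mathcomp Require Import all_boot all_order all_algebra.
From mathcomp Require Import ring_quotient complex.
From mathcomp Require Import all_classical all_reals all_analysis.

Set Implicit Arguments.
Unset Strict Implicit.
Unset Printing Implicit Defensive.

Import Order.TTheory GRing.Theory Num.Theory.
Import numFieldNormedType.Exports.

Local Open Scope classical_set_scope.
Local Open Scope quotient_scope.
Local Open Scope ring_scope.

Definition integers (R : realType) : zmodClosed R :=
  GRing.ZmodClosed.clone R (@Num.int_num_subdef R) _.

(* R/Z: the additive quotient group, with the quotient topology. *)
Definition circle (R : realType) : Type :=
  quotient_topology (Quotient.quot (integers R)).

HB.instance Definition _ (R : realType) := Topological.on (circle R).
HB.instance Definition _ (R : realType) := Quotient.on (circle R).
HB.instance Definition _ (R : realType) :=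
  GRing.isZmodule.Build (circle R)
    (@Quotient.addqA R (integers R)) (@Quotient.addqC R (integers R))
    (@Quotient.add0q R (integers R)) (@Quotient.addNq R (integers R)).

Definition to_circle (R : realType) (t : R) : circle R := \pi_(circle R) t.

Definition torus2 (R : realType) : Type := (circle R * circle R)%type.

HB.instance Definition _ (R : realType) := 
  GRing.Zmodule.copy (torus2 R) (circle R * circle R)%type.
HB.instance Definition _ (R : realType) := 
  Topological.copy (torus2 R) (circle R * circle R)%type.

(* x |-> A x on R^2/Z^2, points being read as column vectors; the integer
   entries of A act on R/Z by the multiples *~ of its group law. *)
Definition toral_endomorphism (R : realType) (A : 'M[int]_2) (x : torus2 R) :
    torus2 R :=
  (x.1 *~ A 0 0 + x.2 *~ A 0 1, x.1 *~ A 1 0 + x.2 *~ A 1 1).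

(* A \in unitmx means det A = 1 or -1, as the coefficients are integers. *)
Definition hyperbolic_toral_automorphism (R : realType)
    (T : torus2 R -> torus2 R) : Prop :=
  exists A : 'M[int]_2,
    [/\ A \in unitmx,
        forall z : R[i], eigenvalue (map_mx intr A) z -> `|z| != 1
      & T = toral_endomorphism A].

Definition skew_product (R : realType) (alpha : R) (T : torus2 R -> torus2 R)
    (h : circle R -> torus2 R) (p : circle R * torus2 R) :
    circle R * torus2 R :=
  (p.1 + to_circle alpha, T p.2 + h p.1).

(* The value at n = 0 is irrelevant to the convergence of the averages. *)
Definition birkhoff_average (R : realType) (X : Type) (f : X -> X)
    (phi : X -> R) (p : X) (n : nat) : R :=
  n%:R^-1 * \sum_(0 <= i < n) phi (iter i f p).

Definition irregular_set (R : realType) (X : Type) (f : X -> X)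
    (phi : X -> R) : set X :=
  [set p | ~ cvgn (birkhoff_average f phi p)].

(* Main.v *)
(* The eigenvalues of the matrix A of T being off the unit circle, with product
   1 or -1, A has a real eigenvalue l with |l| < 1, with an eigenvector (1, s) of
   irrational slope. Translating a point of a fibre by (u, s u) moves the n-th
   iterate by
   (l^n u, s l^n u), which tends to 0, so by uniform continuity of phi and
   Cesaro's lemma the Birkhoff averages at both points converge or diverge
   together. Hence an irregular point makes a dense subset of its fibre
   irregular; the irregular set is also forward invariant, and the base points
   w + n alpha are dense in the circle. *)
Require Import Defs.
From mathcomp Require Import all_boot all_order all_algebra.
From mathcomp Require Import complex ring lra zify.
From mathcomp Require Import all_classical all_reals all_analysis.

Import Order.TTheory GRing.Theory Num.Theory.
Import numFieldNormedType.Exports.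

Local Open Scope classical_set_scope.
Local Open Scope ring_scope.

(** * Diophantine approximation: density of the multiples of an irrational modulo 1 *)

Lemma irrational_small_multiple (R : realType) (b e : R) :
  irrational b -> 0 < e ->
  exists (n : nat) (m : int), n%:R * b + m%:~R != 0 /\
    `|n%:R * b + m%:~R| < e.
Proof.
move=> hb e0.
(* Pigeonhole: [1/N < e], and the [N + 1] fractional parts [fr 0, ..., fr N] fall into [N] intervals
   of length [1/N], so two of them differ by less than [e]. *)
pose N := (Num.truncn e^-1).+1.
have N0 : 0 < N%:R :> R by rewrite ltr0n.
have eN : N%:R^-1 < e.
  by rewrite invf_plt ?posrE// truncnS_gt.
pose fr (j : nat) : R := j%:R * b - (Num.floor (j%:R * b))%:~R.
have fr0 j : 0 <= fr j by rewrite subr_ge0 floor_le.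
have fr1 j : fr j < 1.
  by rewrite ltrBlDr addrC -intrD1 floorD1_gt.
have bucket_lt (j : 'I_N.+1) : (Num.truncn (N%:R * fr j) < N)%N.
  rewrite truncn_lt_nat ?mulr_ge0 ?ler0n// -[ltRHS]mulr1.
  by rewrite ltr_pM2l.
have /injectivePn[i [j ij eqij]] :
    ~~ injectiveb (fun j => Ordinal (bucket_lt j)).
  apply/negP => /injectiveP /leq_card.
  by rewrite !card_ord ltnn.
move: eqij => /(congr1 val) /= eqij.
wlog lt_ij : i j ij eqij / (i < j)%N.
  move=> hw; have /orP[ltij|ltji] : (i < j)%N || (j < i)%N by rewrite -neq_ltn.
    exact: (hw i j).
  by apply: (hw j i) => //; rewrite eq_sym.
exists (j - i)%N, (Num.floor (i%:R * b) - Num.floor (j%:R * b)).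
have -> : (j - i)%:R * b + (Num.floor (i%:R * b) - Num.floor (j%:R * b))%:~R
    = fr j - fr i.
  by rewrite natrB 1?ltnW// intrB /fr; ring.
split.
  (* Equal fractional parts would make [b] the quotient of the difference of the floors by
     [j - i]. *)
  apply/eqP => fr_eq; apply: hb.
  exists ((Num.floor (j%:R * b) - Num.floor (i%:R * b))%:~R / (j - i)%:R) => //.
  rewrite fmorph_div/= ratr_int ratr_nat intrB.
  have ji0 : (j - i)%:R != 0 :> R by rewrite pnatr_eq0 subn_eq0 -ltnNge.
  apply: (mulIf ji0); rewrite divfK// natrB 1?ltnW//.
  by move: fr_eq; rewrite /fr; lra.
apply: lt_trans eN; rewrite -(ltr_pM2l N0) divff ?gt_eqF//.
rewrite -[X in X * _]gtr0_norm// -normrM mulrBr.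
have ge0 k : 0 <= N%:R * fr k by rewrite mulr_ge0 ?ler0n.
have /andP[] := truncn_itv (ge0 i); have /andP[] := truncn_itv (ge0 j).
rewrite eqij -natr1 ltr_norml => *; apply/andP; split; lra.
Qed.

(** A small nonzero [d = n * b + m] serves as a step: walking from an integer by copies of [d] comes
    within [|d|] of [a]. The multiple of [b] stays nonnegative, since it will count forward
    iterates. *)
Lemma irrational_orbit_dense (R : realType) (b a e : R) :
  irrational b -> 0 < e ->
  exists (n : nat) (m : int), `|n%:R * b + m%:~R - a| < e.
Proof.
move=> hb e0; have [n [m [d0 de]]] := irrational_small_multiple _ _ _ hb e0.
set d := n%:R * b + m%:~R in d0 de.
(* The walk starts at the integer next to [a] from which steps of [d] head towards [a], so that
   [(a - M) / d] is nonnegative and can be truncated to a number of steps. *)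
pose M : int := if 0 < d then Num.floor a else Num.floor a + 1.
have quot_ge0 : 0 <= (a - M%:~R) / d.
  have /andP[h1 h2] := floor_itv a; rewrite /M; case: (ltP 0 d) => d0'.
    by rewrite divr_ge0 ?subr_ge0// ltW.
  by rewrite mulr_le0 ?invr_le0// subr_le0 ltW.
pose k := Num.truncn ((a - M%:~R) / d).
exists (k * n)%N, (k%:Z * m + M).
have -> : (k * n)%:R * b + (k%:Z * m + M)%:~R - a
    = d * (k%:R - (a - M%:~R) / d).
  by rewrite intrD intrM natrM mulrBr mulrCA divff// /d -pmulrn; ring.
rewrite normrM; apply: le_lt_trans de; rewrite ler_piMr// ler_norml.
by have /andP[] := truncn_itv quot_ge0; rewrite -/k -natr1 => *; apply/andP; split; lra.
Qed.

(** * The contracting eigenvalue and the stable direction *)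

Lemma det2E (R : comPzRingType) (A : 'M[R]_2) :
  \det A = A 0 0 * A 1 1 - A 0 1 * A 1 0.
Proof.
rewrite (expand_det_row _ 0) !big_ord_recl big_ord0 /cofactor !det_mx11 !mxE /=.
have e1 : lift ord0 ord0 = 1 :> 'I_2 by exact: val_inj.
have e0 : lift 1 ord0 = 0 :> 'I_2 by exact: val_inj.
rewrite !e1 !e0 /=. ring.
Qed.

Lemma char_poly2E (R : comNzRingType) (A : 'M[R]_2) (x : R) :
  (char_poly A).[x] = x ^+ 2 - \tr A * x + \det A.
Proof.
have monA := char_poly_monic A.
rewrite horner_coef size_char_poly !big_ord_recr big_ord0 /= char_poly_det.
rewrite (char_poly_trace A isT) sqrrN expr1n.
by rewrite monicE lead_coefE size_char_poly /= in monA; rewrite (eqP monA); ring.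
Qed.

(** The eigenvalues have product 1 or -1. If real, they are off the unit circle, so one of them lies
    inside; if not, they are conjugate with product 1, hence on the unit circle, which hyperbolicity
    forbids. *)
Lemma contracting_eigenvalue (R : realType) (A : 'M[int]_2) :
  A \in unitmx ->
  (forall z : R[i], eigenvalue (map_mx intr A) z -> `|z| != 1) ->
  exists l : R, `|l| < 1 /\ l ^+ 2 - (\tr A)%:~R * l + (\det A)%:~R = 0.
Proof.
rewrite unitmxE => detA hypA.
have hyp (z : R[i]) :
    z ^+ 2 - (\tr A)%:~R * z + (\det A)%:~R = 0 -> `|z| != 1.
  move=> rz; apply: hypA; rewrite eigenvalue_root_char /root char_poly2E.
  by rewrite det_map_mx trace_map_mx rz.
have hypR (l : R) : l ^+ 2 - (\tr A)%:~R * l + (\det A)%:~R = 0 -> `|l| != 1.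
  move=> rl; have := hyp l%:C%C; rewrite normc_def /= expr0n addr0 sqrtr_sqr.
  rewrite -(inj_eq (@complexI R)); apply.
  rewrite -[RHS](rmorph0 (real_complex R)) -rl.
  by rewrite rmorphD rmorphB !rmorphM !rmorph_int expr2.
set t : R := (\tr A)%:~R in hypR *; set d : R := (\det A)%:~R in hypR *.
have d1 : `|d| = 1.
  by rewrite /d; move: detA => /orP[/eqP->|/eqP->]; rewrite ?rmorphN ?normrN normr1.
have [disc|disc] := leP 0 (t ^+ 2 - 4 * d).
  pose s := Num.sqrt (t ^+ 2 - 4 * d).
  have s2 : s ^+ 2 = t ^+ 2 - 4 * d by rewrite sqr_sqrtr.
  pose l := (t + s) / 2; pose l' := (t - s) / 2.
  have rl : l ^+ 2 - t * l + d = 0 by move: s2; rewrite /l; lra.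
  have rl' : l' ^+ 2 - t * l' + d = 0 by move: s2; rewrite /l'; lra.
  have ll'd : l * l' = d by move: s2; rewrite /l /l'; lra.
  have : `|l| * `|l'| = 1 by rewrite -normrM ll'd.
  have [?|l1 ll'] := ltP `|l| 1; first by exists l.
  exists l'; split=> //; rewrite lt_neqAle hypR//=.
  by rewrite -ll' ler_peMl.
(* For [d = -1] the discriminant would be [t ^+ 2 + 4], which is positive. *)
have dE : d = 1.
  move: disc; move: d1 => /eqP; rewrite eqr_norml ler01 andbT => /orP[]/eqP->// disc.
  by have := sqr_ge0 t; lra.
pose s := Num.sqrt (4 * d - t ^+ 2).
have s2 : s ^+ 2 = 4 * d - t ^+ 2 by rewrite sqr_sqrtr//; lra.
have := hyp ((t / 2) +i* (s / 2))%C; rewrite normc_def /=.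
have -> : (t / 2) ^+ 2 + (s / 2) ^+ 2 = 1 by move: s2; rewrite dE; lra.
rewrite sqrtr1 eqxx => habs; suff: false by []. apply: habs.
have -> : (\tr A)%:~R = t%:C%C by rewrite /t rmorph_int.
have -> : (\det A)%:~R = d%:C%C by rewrite /d rmorph_int.
apply/eqP; rewrite expr2 eq_complex /=; apply/andP; split; apply/eqP.
  by move: s2; lra.
by move: s2; lra.
Qed.

(** Being nonzero with [|l| < 1], the eigenvalue [l] is not an integer. This excludes a vertical
    eigenvector, so one can be normalised to [(1, s)]. Irrationality of [s] will make the stable
    line wind densely around the torus. *)
Lemma stable_direction (R : realType) (A : 'M[int]_2) :
  A \in unitmx ->
  (forall z : R[i], eigenvalue (map_mx intr A) z -> `|z| != 1) ->
  exists l s : R, [/\ `|l| < 1, irrational s,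
    (A 0 0)%:~R + (A 0 1)%:~R * s = l &
    (A 1 0)%:~R + (A 1 1)%:~R * s = l * s].
Proof.
move=> uA hypA; have [l [l1 rl]] := contracting_eigenvalue _ _ uA hypA.
have dA0 : (\det A)%:~R != 0 :> R.
  by move: uA; rewrite unitmxE intr_eq0 => /orP[]/eqP->.
have l0 : l != 0.
  apply: contraNneq dA0 => l0; move: rl.
  by rewrite l0 expr0n mulr0 subr0 add0r => ->.
have lint (k : int) : l != k%:~R.
  apply/eqP => lk; move: l1 l0; rewrite lk -intr_norm intr_eq0 -normr_gt0.
  by rewrite ltrz1; lia.
rewrite det2E /mxtrace big_ord_recr big_ord1 /= in rl.
have e0 : widen_ord (leqnSn 1) ord0 = 0 :> 'I_2 by exact: val_inj.
have e1 : ord_max = 1 :> 'I_2 by exact: val_inj.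
rewrite {}e0 {}e1 intrD intrB !intrM in rl.
set a := A 0 0 in rl *; set b := A 0 1 in rl *.
set c := A 1 0 in rl *; set d := A 1 1 in rl *.
(* If [b = 0], the matrix is triangular and its eigenvalues are the integers [a] and [d]. *)
have b0 : b%:~R != 0 :> R.
  apply/eqP => b0; have /eqP : (l - a%:~R) * (l - d%:~R) = 0.
    by move: rl; rewrite b0; lra.
  by rewrite mulf_eq0 !subr_eq0 !(negbTE (lint _)).
pose s := (l - a%:~R) / b%:~R.
have bs : a%:~R + b%:~R * s = l by rewrite /s mulrC divfK// addrC subrK.
have ds : c%:~R + d%:~R * s = l * s.
  apply: (mulfI b0); have -> : l = a%:~R + b%:~R * s by [].
  by move: rl; rewrite -bs; lra.
exists l, s; split=> // -[q _ qs].
(* Multiplication by [l] maps integers [k] such that [k * s] is an integer to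
   smaller nonzero ones: infinite descent. *)
have descent n (k m : int) : (absz k < n)%N -> k != 0 -> k%:~R * s <> m%:~R.
  elim: n k m => // n IH k m kn k0 km.
  have lk : l * k%:~R = (a * k + b * m)%:~R.
    by rewrite -bs intrD !intrM -km; ring.
  apply: (IH (a * k + b * m) (c * k + d * m)).
  - have : `|a * k + b * m| < `|k|.
      rewrite -(ltr_int R) !intr_norm -lk normrM gtr_pMl ?normr_gt0 ?intr_eq0//.
    by lia.
  - by rewrite -(intr_eq0 R) -lk mulf_neq0 ?intr_eq0.
  - rewrite -lk mulrAC -ds intrD !intrM -km; ring.
apply: (descent _ (denq q) (numq q) (ltnSn _) (denq_neq0 q)).
by rewrite -qs /ratr mulrC divfK// intr_eq0 denq_neq0.
Qed.

(** * The quotient map from the line to the circle, and uniform continuity *)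

Lemma to_circleD (R : realType) (x y : R) :
  to_circle (x + y) = to_circle x + to_circle y.
Proof. exact: Quotient.pi_add. Qed.

Lemma to_circle0 (R : realType) : to_circle (0 : R) = 0.
Proof. by apply: (addrI (to_circle 0)); rewrite -to_circleD !addr0. Qed.

Lemma to_circle_int (R : realType) (m : int) : to_circle (m%:~R : R) = 0.
Proof.
have /eqP : \pi_(Quotient.quot (integers R))%qT (m%:~R : R)
    == \pi_(Quotient.quot (integers R))%qT 0.
  by rewrite -Quotient.idealrBE subr0 intr_int.
by move=> pim0; rewrite -to_circle0 /to_circle; exact: pim0.
Qed.

Lemma to_circleMz (R : realType) (x : R) (m : int) :
  to_circle x *~ m = to_circle (m%:~R * x).
Proof.
have to_circleMn n : to_circle x *+ n = to_circle (n%:R * x).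
  elim: n => [|n IH]; first by rewrite mul0r to_circle0.
  by rewrite mulrS IH -to_circleD -nat1r mulrDl mul1r.
case: m => n; first exact: to_circleMn.
rewrite NegzE mulrNz -pmulrn to_circleMn rmorphN mulNr /=.
by apply/eqP; rewrite eq_sym -addr_eq0 -to_circleD addNr to_circle0.
Qed.

Lemma to_circle_continuous (R : realType) : continuous (@to_circle R).
Proof. exact: pi_continuous. Qed.

Lemma to_circle_surj (R : realType) (z : circle R) :
  exists2 t : R, t \in `[0, 1] & to_circle t = z.
Proof.
pose t : R := repr z; exists (t - (Num.floor t)%:~R).
  rewrite in_itv/= subr_ge0 floor_le/= lerBlDr addrC.
  by have := floorD1_gt t; rewrite intrD => /ltW.
by rewrite -intrN to_circleD to_circle_int addr0 /to_circle reprK.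
Qed.

(** Points are lifted to the compact cube [[0, 1]^3]; compactness, in its near-covering form, yields
    one neighbourhood of displacements valid for all points, without any metric on the torus. *)
Lemma circle_uniform_continuity (R : realType)
    (phi : circle R * torus2 R -> R) (e : R) :
  continuous phi -> 0 < e ->
  \forall d \near ((0, 0) : R * R), forall p : circle R * torus2 R,
    `|phi (p.1, p.2 + (to_circle d.1, to_circle d.2)) - phi p| < e.
Proof.
move=> cphi e0; pose I := [set` `[0, 1]] : set R.
pose pt (q : R * (R * R)) (d : R * R) : circle R * torus2 R :=
  (to_circle q.1, (to_circle (q.2.1 + d.1), to_circle (q.2.2 + d.2))).
have pt_cont : continuous (fun z => pt z.1 z.2).
  move=> z.
  have z1 : w.1 @[w --> z] --> z.1 by exact: cvg_fst.
  have z2 : w.2 @[w --> z] --> z.2 by exact: cvg_snd.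
  have z11 : w.1.1 @[w --> z] --> z.1.1 by apply: (cvg_comp _ _ z1); exact: cvg_fst.
  have z12 : w.1.2 @[w --> z] --> z.1.2 by apply: (cvg_comp _ _ z1); exact: cvg_snd.
  have z121 : w.1.2.1 @[w --> z] --> z.1.2.1 by apply: (cvg_comp _ _ z12); exact: cvg_fst.
  have z122 : w.1.2.2 @[w --> z] --> z.1.2.2 by apply: (cvg_comp _ _ z12); exact: cvg_snd.
  have z21 : w.2.1 @[w --> z] --> z.2.1 by apply: (cvg_comp _ _ z2); exact: cvg_fst.
  have z22 : w.2.2 @[w --> z] --> z.2.2 by apply: (cvg_comp _ _ z2); exact: cvg_snd.
  have c1 : to_circle w.1.1 @[w --> z] --> to_circle z.1.1.
    exact: (cvg_comp _ _ z11 (to_circle_continuous _ _)).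
  have c2 : to_circle (w.1.2.1 + w.2.1) @[w --> z] --> to_circle (z.1.2.1 + z.2.1).
    exact: (cvg_comp _ _ (cvgD z121 z21) (to_circle_continuous _ _)).
  have c3 : to_circle (w.1.2.2 + w.2.2) @[w --> z] --> to_circle (z.1.2.2 + z.2.2).
    exact: (cvg_comp _ _ (cvgD z122 z22) (to_circle_continuous _ _)).
  exact: (cvg_pair c1 (cvg_pair c2 c3)).
have /compact_near_coveringP cov : compact (I `*` (I `*` I)).
  by do 2![apply: compact_setX; first exact: segment_compact];
    exact: segment_compact.
pose P (d : R * R) q := `|phi (pt q d) - phi (pt q (0, 0))| < e.
have pt0 q : pt q (0, 0) = (to_circle q.1, (to_circle q.2.1, to_circle q.2.2)).
  by rewrite /pt /= !addr0.
(* Near [(q, (0, 0))] the displaced and the undisplaced values of [phi] have the same limit, so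
   their difference tends to 0. *)
have cover : forall q, (I `*` (I `*` I)) q ->
    \forall q' \near q & d \near ((0, 0) : R * R), P d q'.
  move=> q _.
  have cpt : phi (pt w.1 w.2) @[w --> (q, (0, 0))] --> phi (pt q (0, 0)).
    by apply: (cvg_comp _ _ (pt_cont (q, (0, 0)))); exact: cphi.
  have proj : (w.1, ((0, 0) : R * R)) @[w --> (q, ((0, 0) : R * R))] -->
      (q, ((0, 0) : R * R)).
    by apply: (@cvg_pair _ _ _ _ (nbhs q) (nbhs ((0, 0) : R * R)));
      [exact: cvg_fst|exact: cvg_cst].
  have cpt0 : phi (pt w.1 (0, 0)) @[w --> (q, ((0, 0) : R * R))] -->
      phi (pt q (0, 0)) by exact: (cvg_comp _ _ proj cpt).
  have cvg0 : phi (pt w.1 w.2) - phi (pt w.1 (0, 0))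
      @[w --> (q, ((0, 0) : R * R))] --> (0 : R).
    rewrite -[X in _ --> X](subrr (phi (pt q (0, 0)))).
    exact: (cvgB cpt cpt0).
  exact: (@cvgr0_norm_lt R R _ _ _ _ cvg0 e e0).
have := cov _ _ P (nbhs_filter ((0, 0) : R * R)) cover.
apply: filterS => d Kd p; have [a Ia pa] := to_circle_surj _ p.1.
have [b Ib pb] := to_circle_surj _ p.2.1.
have [c Ic pc] := to_circle_surj _ p.2.2.
have /Kd : (I `*` (I `*` I)) (a, (b, c)) by [].
rewrite /P pt0 /pt /= !to_circleD pa pb pc.
by case: p {pa pb pc} => ? [].
Qed.

(** * Convergence of Birkhoff averages *)

Lemma birkhoff_average_cvg_asymptotic (R : realType) (X : Type) (f : X -> X)
    (phi : X -> R) (p q : X) :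
  (fun n => phi (iter n f q) - phi (iter n f p)) @ \oo --> 0 ->
  cvgn (birkhoff_average f phi p) -> cvgn (birkhoff_average f phi q).
Proof.
move=> /cesaro diff0 /cvg_ex[/= l cvgp].
(* The Cesaro mean of index [n] has [n.+1] terms, hence the shift by one. *)
apply/cvg_ex; exists (0 + l); rewrite -cvg_shiftS.
have cvgpS : birkhoff_average f phi p n.+1 @[n --> \oo] --> l.
  by rewrite (cvg_shiftS (birkhoff_average f phi p)).
apply: cvg_trans (cvgD diff0 cvgpS).
apply: near_eq_cvg; near=> n; rewrite /= fctE /arithmetic_mean /birkhoff_average /=.
by rewrite -mulrDr /series/= sumrB subrK.
Unshelve. all: by end_near. Qed.

(** The average of [n.+1] terms from [p] is a convex combination of [phi p], with weight [1 / n.+1],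
    and the average of [n] terms from [f p]. The contrapositive gives forward invariance of the
    irregular set. *)
Lemma birkhoff_average_cvg_preimage (R : realType) (X : Type) (f : X -> X)
    (phi : X -> R) (p : X) :
  cvgn (birkhoff_average f phi (f p)) -> cvgn (birkhoff_average f phi p).
Proof.
move=> /cvg_ex[/= l cvgp].
have cvgV : (n.+1%:R^-1 : R) @[n --> \oo] --> (0 : R) by exact: cvg_harmonic.
apply/cvg_ex; exists (0 * phi p + (1 - 0) * l); rewrite -cvg_shiftS.
have cvg1V : (1 - n.+1%:R^-1 : R) @[n --> \oo] --> (1 - 0 : R).
  by apply: cvgB; [exact: cvg_cst|exact: cvgV].
have lim : n.+1%:R^-1 * phi p
    + (1 - n.+1%:R^-1) * birkhoff_average f phi (f p) n
    @[n --> \oo] --> 0 * phi p + (1 - 0) * l.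
  by apply: cvgD; apply: cvgM => //; exact: cvg_cst.
apply: cvg_trans lim; apply: near_eq_cvg; near=> n.
have n0 : n%:R != 0 :> R.
  by rewrite pnatr_eq0 -lt0n; near: n; exact: nbhs_infty_gt.
have n1 : n.+1%:R != 0 :> R by rewrite pnatr_eq0.
rewrite /= /birkhoff_average big_nat_recl// mulrDr; congr (_ + _).
have -> : 1 - n.+1%:R^-1 = n.+1%:R^-1 * n%:R :> R.
  by apply: (mulfI n1); rewrite mulrA divff// mul1r mulrBr divff// mulr1 -natr1 addrK.
rewrite -mulrA mulVKf//; congr (_ * _).
by apply: eq_bigr => i _; rewrite -iterSr.
Unshelve. all: by end_near. Qed.

(** * Translations along the stable line *)

Definition stable_point (R : realType) (s u : R) : torus2 R :=
  (to_circle u, to_circle (s * u)).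

Lemma toral_endomorphismD (R : realType) (A : 'M[int]_2) (x y : torus2 R) :
  toral_endomorphism A (x + y) =
  toral_endomorphism A x + toral_endomorphism A y.
Proof. by congr pair; rewrite /= !mulrzDl addrACA. Qed.

Lemma toral_endomorphism_stable_point (R : realType) (A : 'M[int]_2)
    (l s u : R) :
  (A 0 0)%:~R + (A 0 1)%:~R * s = l ->
  (A 1 0)%:~R + (A 1 1)%:~R * s = l * s ->
  toral_endomorphism A (stable_point _ s u) = stable_point _ s (l * u).
Proof.
move=> e1 e2; congr pair; rewrite /= !to_circleMz -to_circleD; congr to_circle.
  by rewrite -e1; ring.
by rewrite (mulrCA s) mulrA -e2; ring.
Qed.

(** This serves twice: with [alpha] in the base, and with [s] in the second coordinate of a
    fibre. *)
Lemma circle_rotation_dense (R : realType) (b : R) (c z : circle R)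
    (U : set (circle R)) :
  irrational b -> nbhs z U -> exists n : nat, U (c + to_circle (n%:R * b)).
Proof.
move=> hb; have [t _ <-] := to_circle_surj _ z; have [a _ <-] := to_circle_surj _ c.
move=> /to_circle_continuous/nbhs_ballP[e /= e0 tU].
have [n [m nm]] := irrational_orbit_dense _ b (t - a) e hb e0.
exists n; suff : U (to_circle (a + n%:R * b + m%:~R)).
  by rewrite !to_circleD to_circle_int addr0.
apply: tU; rewrite /ball/= -normrN.
by apply: le_lt_trans nm; rewrite le_eqVlt; apply/orP; left; apply/eqP; congr `|_|; ring.
Qed.

Lemma skew_product_iter_fst (R : realType) (alpha : R) T h p n :
  (iter n (skew_product alpha T h) p).1 = p.1 + to_circle (n%:R * alpha).
Proof.
elim: n => [|n IH]; first by rewrite mul0r to_circle0 addr0.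
by rewrite iterS /= IH -addrA -to_circleD -natr1 mulrDl mul1r.
Qed.

(** The term [h] depends on the base point alone and the fibre map is additive, so a displacement
    inside a fibre evolves under the linear map only. *)
Lemma skew_product_iter_stable_point (R : realType) (alpha : R)
    (A : 'M[int]_2) h (l s u : R) (p : circle R * torus2 R) (n : nat) :
  (A 0 0)%:~R + (A 0 1)%:~R * s = l ->
  (A 1 0)%:~R + (A 1 1)%:~R * s = l * s ->
  let F := skew_product alpha (toral_endomorphism A) h in
  iter n F (p.1, p.2 + stable_point _ s u) =
  ((iter n F p).1, (iter n F p).2 + stable_point _ s (l ^+ n * u)).
Proof.
move=> e1 e2 /=; elim: n => [|n IH]; first by rewrite mul1r.
rewrite 2!iterS IH /skew_product /= toral_endomorphismD.
by rewrite (toral_endomorphism_stable_point _ _ _ _ _ e1 e2) exprS mulrA addrAC.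
Qed.

Lemma stable_point_asymptotic (R : realType) (alpha : R)
    (A : 'M[int]_2) h (phi : circle R * torus2 R -> R)
    (l s u : R) (p : circle R * torus2 R) :
  continuous phi -> `|l| < 1 ->
  (A 0 0)%:~R + (A 0 1)%:~R * s = l ->
  (A 1 0)%:~R + (A 1 1)%:~R * s = l * s ->
  let F := skew_product alpha (toral_endomorphism A) h in
  phi (iter n F (p.1, p.2 + stable_point _ s u)) - phi (iter n F p)
    @[n --> \oo] --> (0 : R).
Proof.
move=> cphi l1 e1 e2 F; apply/(@cvgr0Pnorm_lt R R) => e e0.
have lu0 : l ^+ n * u @[n --> \oo] --> (0 : R).
  by rewrite -[X in _ --> X](mul0r u); apply: cvgM; [exact: cvg_expr|exact: cvg_cst].
have slu0 : s * (l ^+ n * u) @[n --> \oo] --> (0 : R).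
  by rewrite -[X in _ --> X](mulr0 s); apply: cvgM => //; exact: cvg_cst.
(* Uniformity in [q] is essential: the bound is applied at [iter n F p], which moves with [n]. *)
have unif : \forall n \near \oo, forall q : circle R * torus2 R,
    `|phi (q.1, q.2 + stable_point _ s (l ^+ n * u)) - phi q| < e.
  exact: (cvg_pair lu0 slu0 (circle_uniform_continuity _ _ _ cphi e0)).
near=> n; rewrite (skew_product_iter_stable_point _ _ _ _ _ _ _ _ _ e1 e2).
by near: n; apply: filterS unif => n; exact.
Unshelve. all: by end_near. Qed.

(** * Density of the irregular set *)

Theorem corollary5 (R : realType) (alpha : R) (T : torus2 R -> torus2 R)
    (h : circle R -> torus2 R) (phi : circle R * torus2 R -> R)
    (halpha : irrational alpha)
    (hT : hyperbolic_toral_automorphism T)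
    (hh : continuous h)
    (hphi : continuous phi) :
  irregular_set (skew_product alpha T h) phi = set0 \/
  dense (irregular_set (skew_product alpha T h) phi).
Proof.
have [A [uA hypA ->]] := hT.
have [l [s [l1 hs e1 e2]]] := stable_direction _ _ uA hypA.
set F := skew_product _ _ _.
have [irr0|irrN0] := pselect (irregular_set F phi = set0); first by left.
have [p irr_p] : irregular_set F phi !=set0 by exact/set0P/eqP.
right=> O [z Oz] oO; have irr_iter n : irregular_set F phi (iter n F p).
  elim: n => // n IH; rewrite iterS /irregular_set /=.
  by apply: contra_not IH; exact: birkhoff_average_cvg_preimage.
have irr_stable q u : irregular_set F phi q ->
    irregular_set F phi (q.1, q.2 + stable_point _ s u).
  (* Convergence has to pass from the translated point back to [q], so the difference is needed with
     the opposite sign. *)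
  apply: contra_not; apply: birkhoff_average_cvg_asymptotic.
  have := stable_point_asymptotic _ alpha A h phi l s u q hphi l1 e1 e2.
  rewrite -/F => /cvgN; rewrite oppr0; apply: cvg_trans.
  by apply: near_eq_cvg; near=> n; rewrite /= opprB.
have [[U1 U2] /= [zU1 [[V W] /= [zV zW] VWU2]] UO] : nbhs z O by exact: open_nbhs_nbhs.
have [n U1n] := circle_rotation_dense _ _ p.1 _ _ halpha zU1.
set q := iter n F p; have [x _ xz] := to_circle_surj _ z.2.1.
have [c _ cq] := to_circle_surj _ q.2.1.
(* Every translation parameter [x - c + k] with [k] a natural number brings the first fibre
   coordinate exactly to [z.2.1], while each increment of [k] rotates the second one by [s]; some
   [k] thus puts it in [W]. *)
have [k Wk] := circle_rotation_dense _ _ (q.2.2 + to_circle (s * (x - c))) _ _ hs zW.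
exists (q.1, q.2 + stable_point _ s (x - c + k%:R)); split; last first.
  exact/irr_stable/irr_iter.
apply: UO; split; first by rewrite /q skew_product_iter_fst.
apply: VWU2; split=> /=.
  rewrite -cq -to_circleD addrA (addrC c) subrK to_circleD (pmulrn 1 k).
  rewrite to_circle_int addr0 xz.
  exact: nbhs_singleton.
by rewrite mulrDr to_circleD addrA (mulrC s k%:R).
Unshelve. all: by end_near. Qed.
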